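(* Let $m>0$, $\Omega>0$, $R_{\max}>0$ and $\varepsilon\in(0,1)$. Put $\beta=1+\frac m\Omega$ and, for integers $k\ge1$, $r\ge0$ and $\phi\in\mathbb{R}$, $$w_k(\phi)=(-1)^k\,2e^{-\frac12\sigma_\Theta^2k^2}\cos(k\phi),\qquad I_{k,m}(r)=\frac{\Gamma\left(m+\frac k2\right)}{2\beta^{m+\frac k2}\,k!}\,r^k\,{}_1F_1\left(m+\frac k2;k+1;\frac{r^2}{\beta}\right),$$ where $$\sigma_\Theta^2=\sigma_\Theta^2(m)=\frac{\pi^2}{4}+\frac{\int_0^\pi t^2\sin^{m-1}t\,dt}{4\sqrt\pi\,C(m)},\qquad C(m)=\frac{\Gamma(m/2)}{\Gamma((m+1)/2)}.$$ Then there exists a finite truncation index $K$ such that $$\sum_{k>K}|w_k(\phi)|\,I_{k,m}(r)\le\varepsilon\qquad\text{for all } r\in[0,R_{\max}]\text{ and all }\phi\in\mathbb{R}.$$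
   Context: $\Gamma$ is the Gamma function and ${}_1F_1$ is the confluent hypergeometric function of the first kind. A truncation index is a nonnegative integer. *)

(* Defs.v *)
From HB Require Import structures.
From mathcomp Require Export all_boot all_order all_algebra.
From mathcomp Require Export all_classical all_reals all_analysis.
Export Order.TTheory GRing.Theory Num.Theory.
Export numFieldNormedType.Exports.

Set Implicit Arguments.
Unset Strict Implicit.
Unset Printing Implicit Defensive.

Local Open Scope classical_set_scope.
Local Open Scope ring_scope.

(** Used for [0 < x] only, where the Lebesgue integral is finite (otherwise it
    is [+oo] and [Rintegral] returns 0). *)
Definition Gamma (R : realType) (x : R) : R :=
  Rintegral (@lebesgue_measure R) `]0, +oo[
    (fun t => t `^ (x - 1) * expR (- t)).

Definition rising_factorial (R : realType) (a : R) (n : nat) : R :=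
  \prod_(i < n) (a + i%:R).

(** The series converges for every [a] and [z] as soon as [b] is not a
    nonpositive integer; below, [b] is always a positive integer. *)
Definition hyp1F1 (R : realType) (a b z : R) : R :=
  limn (series (fun n : nat =>
    rising_factorial a n / rising_factorial b n * (z ^+ n / n`!%:R))).

Definition Cm (R : realType) (m : R) : R := Gamma (m / 2) / Gamma ((m + 1) / 2).

(** For [m < 1] the integrand is unbounded near [pi] (and [powR] sends 0 to 0
    at the endpoints), but it is Lebesgue integrable for every [0 < m]. *)
Definition sigma2_Theta (R : realType) (m : R) : R :=
  pi ^+ 2 / 4 +
  Rintegral (@lebesgue_measure R) `[0, pi]
    (fun t => t ^+ 2 * (sin t) `^ (m - 1)) / (4 * Num.sqrt pi * Cm m).

Definition w (R : realType) (m : R) (k : nat) (phi : R) : R :=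
  (-1) ^+ k * (2 * expR (- (1 / 2 * sigma2_Theta m * k%:R ^+ 2))
                 * cos (k%:R * phi)).

Definition beta (R : realType) (m Omega : R) : R := 1 + m / Omega.

Definition I_km (R : realType) (m Omega : R) (k : nat) (r : R) : R :=
  Gamma (m + k%:R / 2) / (2 * beta m Omega `^ (m + k%:R / 2) * k`!%:R)
  * r ^+ k
  * hyp1F1 (m + k%:R / 2) (k%:R + 1) (r ^+ 2 / beta m Omega).

(* Main.v *)
(** For [k >= 2] the bound [sqrt t ^+ (k - 2) <= k! * expR (sqrt t)] under the
    integral sign bounds [Gamma (m + k / 2) / k!] independently of [k], and
    termwise comparison of the two series bounds the hypergeometric factor by
    [expR ((m + 1) * z)]. Hence [I_km] grows at most like [Rmax ^+ k], which the
    Gaussian factor of [w], available because [sigma2_Theta m >= 1], beats. *)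
Require Import Defs.
From mathcomp Require Import measurable_realfun ring lra.

Set Implicit Arguments.
Unset Strict Implicit.
Unset Printing Implicit Defensive.

Local Open Scope classical_set_scope.
Local Open Scope ring_scope.

Lemma exprn_le_fact_expR (R : realType) (x : R) (n : nat) :
  0 <= x -> x ^+ n <= n`!%:R * expR x.
Proof.
move=> x0; rewrite mulrC -ler_pdivrMr ?ltr0n ?fact_gt0//.
case: n => [|n]; first by rewrite expr0 divr1 -expR0 ler_expR.
by apply: le_trans (expR_ge1Dxn n x0); rewrite lerDr.
Qed.

Lemma powR_le_expR (R : realType) (a t : R) :
  0 < a -> 0 <= t -> t `^ a <= (4 * a) `^ a * expR (t / 4).
Proof.
move=> a0 t0.
have a4 : 0 < 4 * a by rewrite mulr_gt0.
have u0 : 0 <= t / (4 * a) by rewrite divr_ge0 // ltW.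
have -> : t `^ a = (4 * a * (t / (4 * a))) `^ a.
  by congr (_ `^ _); field; rewrite gt_eqF.
rewrite powRM ?(ltW a4) // ler_wpM2l ?powR_ge0 //.
have -> : expR (t / 4) = expR (t / (4 * a)) `^ a.
  by rewrite -expRM; congr expR; field; rewrite gt_eqF.
apply: ge0_ler_powR; rewrite ?nnegrE ?expR_ge0 ?(ltW a0) //.
by apply: le_trans (expR_ge1Dx _); rewrite lerDr.
Qed.

Lemma Gamma_ge0 (R : realType) (x : R) : 0 <= Gamma x.
Proof.
by apply: Rintegral_ge0 => t _; rewrite mulr_ge0 ?powR_ge0 ?expR_ge0.
Qed.

Lemma Gamma_integrand_le (R : realType) (m t : R) (j : nat) :
  0 < m -> 0 < t ->
  t `^ (m + j.+2%:R / 2 - 1) * expR (- t)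
  <= j`!%:R * ((4 * m) `^ m * expR (1 / 2)) * expR (- (t / 4)).
Proof.
move=> m0 t0.
have -> : m + j.+2%:R / 2 - 1 = m + 2^-1 * j%:R.
  by rewrite -addn2 natrD; field.
rewrite powRD; last by rewrite (gt_eqF t0) implybT.
rewrite powRrM powR12_sqrt ?(ltW t0) // powR_mulrn ?sqrtr_ge0 //.
have h1 := powR_le_expR m0 (ltW t0).
have h2 := exprn_le_fact_expR j (sqrtr_ge0 t).
(* Since [(sqrt t - 1) ^+ 2 >= 0], [sqrt t <= 1 / 2 + t / 2]. *)
have h3 : expR (Num.sqrt t) <= expR (1 / 2) * expR (t / 2).
  rewrite -expRD ler_expR; have := sqr_sqrtr (ltW t0).
  by have := sqr_ge0 (Num.sqrt t - 1); nra.
have -> : expR (- (t / 4)) = expR (t / 4) * expR (t / 2) * expR (- t).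
  by rewrite -!expRD; congr expR; field.
rewrite [leRHS](_ : _ = ((4 * m) `^ m * expR (t / 4)) *
   (j`!%:R * (expR (1 / 2) * expR (t / 2))) * expR (- t)); last by ring.
rewrite ler_wpM2r ?expR_ge0 // ler_pM ?powR_ge0 ?exprn_ge0 ?sqrtr_ge0 //.
by apply: (le_trans h2); rewrite ler_wpM2l.
Qed.

(** The majorant of the integrand is a multiple of the exponential density of rate 1/4; the factor 4
    cancels the rate. *)
Lemma Gamma_le_fact (R : realType) (m : R) (j : nat) :
  0 < m ->
  Gamma (m + j.+2%:R / 2) <= j`!%:R * (4 * ((4 * m) `^ m * expR (1 / 2))).
Proof.
move=> m0.
pose C := j`!%:R * (4 * ((4 * m) `^ m * expR (1 / 2))) : R.
have C0 : 0 <= C by rewrite !mulr_ge0 ?powR_ge0 ?expR_ge0.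
have r0 : (0 : R) < 4^-1 by rewrite invr_gt0.
have intT := integrable_exponential_pdf r0.
have intD : (@lebesgue_measure R).-integrable `]0, +oo[
    (EFin \o exponential_pdf (4^-1 : R)).
  exact: integrableS intT.
have intC : (@lebesgue_measure R).-integrable `]0, +oo[
    (EFin \o (fun t => C * exponential_pdf (4^-1 : R) t)).
  exact: (integrableZl _ C intD).
have le_pdf t : t \in `]0, +oo[ -> t `^ (m + j.+2%:R / 2 - 1) * expR (- t)
    <= C * exponential_pdf (4^-1 : R) t.
  rewrite in_itv /= andbT => t0; rewrite exponential_pdfE ?(ltW t0) //.
  apply: (le_trans (Gamma_integrand_le j m0 t0)).
  rewrite /C mulNr [4^-1 * t]mulrC.
  by rewrite le_eqVlt; apply/orP; left; apply/eqP; field.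
rewrite /Gamma -/C.
apply: (@le_trans _ _ (Rintegral (@lebesgue_measure R) `]0, +oo[
    (fun t => C * exponential_pdf (4^-1 : R) t))).
  apply: le_Rintegral => //.
  (* The same domination gives the integrability of the Gamma integrand. *)
  apply: le_integrable intC => //.
    apply/measurable_EFinP; apply: measurable_funTS.
    apply: measurable_funM; first exact: measurable_realfun.measurable_powR.
    by apply: measurableT_comp => //; exact: measurable_expR.
  move=> t /= t0; rewrite !lee_fin ger0_norm; last first.
    by rewrite mulr_ge0 ?powR_ge0 ?expR_ge0.
  by apply: le_trans (ler_norm _); exact: le_pdf.
rewrite RintegralZl // -[leRHS]mulr1 ler_wpM2l //.
rewrite -lee_fin /Rintegral fineK; last exact: integrable_fin_num.
(* The density has total mass 1 on the whole line, hence at most 1 on the half-line. *)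
rewrite -(integral_exponential_pdf r0); apply: ge0_subset_integral => //.
- by apply/measurable_EFinP; exact: measurable_exponential_pdf.
- by move=> t _; rewrite lee_fin exponential_pdf_ge0 // ltW.
Qed.

Lemma rising_factorial_gt0 (R : realType) (a : R) (n : nat) :
  0 < a -> 0 < rising_factorial a n.
Proof. by move=> a0; apply: prodr_gt0 => i _; rewrite ltr_wpDr. Qed.

(** Factor by factor, [a + i <= M * (b + i)], where [1 <= M] handles [i]. *)
Lemma rising_factorial_le (R : realType) (a b M : R) (n : nat) :
  0 < a -> a <= M * b -> 1 <= M ->
  rising_factorial a n <= M ^+ n * rising_factorial b n.
Proof.
move=> a0 aMb M1; rewrite /rising_factorial.
have <- : \prod_(i < n) M = M ^+ n by rewrite prodr_const card_ord.
rewrite -big_split /=.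
apply: ler_prod => i _; rewrite addr_ge0 ?(ltW a0) //= mulrDr lerD //.
by rewrite ler_peMl.
Qed.

Lemma hyp1F1_bounds (R : realType) (a b M z : R) :
  0 < a -> 0 < b -> a <= M * b -> 1 <= M -> 0 <= z ->
  0 <= hyp1F1 a b z <= expR (M * z).
Proof.
move=> a0 b0 aMb M1 z0.
set u := (fun n : nat =>
  rising_factorial a n / rising_factorial b n * (z ^+ n / n`!%:R)).
have u0 n : 0 <= u n.
  by rewrite mulr_ge0 ?divr_ge0 ?exprn_ge0 // ltW // rising_factorial_gt0.
have ule n : u n <= exp_coeff (M * z) n.
  rewrite /u /exp_coeff /= exprMn -[leRHS]mulrA ler_wpM2r ?divr_ge0 ?exprn_ge0 //.
  by rewrite ler_pdivrMr ?rising_factorial_gt0 // rising_factorial_le.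
(* Convergence must be known before [limn] can be compared: only then is it the sum of the
   series. *)
have cvgu : cvgn (series u).
  apply: series_le_cvg (is_cvg_series_exp_coeff (M * z)) => // n.
  exact: le_trans (u0 n) (ule n).
apply/andP; split.
  by apply: limr_ge => //; apply: nearW => n; apply: sumr_ge0 => i _; exact: u0.
exact: lim_series_le cvgu (is_cvg_series_exp_coeff _) ule.
Qed.

(** As [pi >= 2], the term [pi ^+ 2 / 4] already reaches 1; the other summand is nonnegative. *)
Lemma sigma2_Theta_ge1 (R : realType) (m : R) : 1 <= sigma2_Theta m.
Proof.
rewrite /sigma2_Theta -[1]addr0 lerD //.
  by rewrite ler_pdivlMr // mul1r; have := pi_ge2 R; nra.
apply: divr_ge0.
  by apply: Rintegral_ge0 => t _; rewrite mulr_ge0 ?sqr_ge0 ?powR_ge0.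
by rewrite !mulr_ge0 ?sqrtr_ge0 ?invr_ge0 ?Gamma_ge0.
Qed.

Lemma normr_w_le (R : realType) (m phi : R) (k : nat) :
  `|w m k phi| <= 2 * expR (- (k%:R ^+ 2 / 2)).
Proof.
rewrite /w !normrM normrX normrN1 expr1n [leLHS]mul1r (ger0_norm (expR_ge0 _)).
rewrite (ger0_norm (ler0n R 2)) -[leRHS]mulr1.
apply: ler_pM; rewrite ?mulr_ge0 ?expR_ge0 ?ler_norml ?cos_geN1 ?cos_le1 //.
rewrite ler_wpM2l // ler_expR lerN2.
have := sigma2_Theta_ge1 m; have := sqr_ge0 (k%:R : R).
nra.
Qed.

Lemma I_km_bounds (R : realType) (m Omega Rmax r : R) (k : nat) :
  0 < m -> 0 < Omega -> 0 <= r <= Rmax -> (1 < k)%N ->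
  0 <= I_km m Omega k r <=
    2 * ((4 * m) `^ m * expR (1 / 2)) * expR ((m + 1) * Rmax ^+ 2) * Rmax ^+ k.
Proof.
move=> m0 Omega0 /andP[r0 rR]; case: k => [|[|j]] // _.
have beta1 : 1 <= beta m Omega by rewrite lerDl divr_ge0 ?ltW.
have beta0 : 0 < beta m Omega by apply: lt_le_trans beta1.
have a0 : 0 < m + j.+2%:R / 2 by rewrite ltr_wpDr ?divr_ge0.
have /andP[F0 Fle] : 0 <= hyp1F1 (m + j.+2%:R / 2) (j.+2%:R + 1)
    (r ^+ 2 / beta m Omega) <= expR ((m + 1) * (r ^+ 2 / beta m Omega)).
  (* [M = m + 1] is admissible, uniformly in [k], because [m + k / 2 <= (m + 1) * (k + 1)]. *)
  apply: hyp1F1_bounds => //.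
  - by have : 0 <= (j.+2%:R : R) by []; nra.
  - by rewrite lerDr ltW.
  - by rewrite divr_ge0 ?sqr_ge0 // ltW.
have F1 : hyp1F1 (m + j.+2%:R / 2) (j.+2%:R + 1) (r ^+ 2 / beta m Omega)
    <= expR ((m + 1) * Rmax ^+ 2).
  apply: (le_trans Fle); rewrite ler_expR ler_wpM2l ?addr_ge0 ?(ltW m0) //.
  rewrite ler_pdivrMr //; apply: (@le_trans _ _ (Rmax ^+ 2)).
    by rewrite lerXn2r ?nnegrE // (le_trans r0).
  by rewrite ler_peMr ?sqr_ge0.
have p1 : 1 <= beta m Omega `^ (m + j.+2%:R / 2).
  by apply: le_trans (ler_powR beta1 (ltW a0)); rewrite powRr0.
have den0 : 0 < 2 * beta m Omega `^ (m + j.+2%:R / 2) * (j.+2)`!%:R.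
  by rewrite !mulr_gt0 ?ltr0n ?fact_gt0 // (lt_le_trans _ p1).
rewrite /I_km; apply/andP; split.
  by apply: mulr_ge0 => //; rewrite mulr_ge0 ?exprn_ge0 ?divr_ge0 ?Gamma_ge0 // ltW.
rewrite mulrAC ler_pM ?lerXn2r ?nnegrE ?(le_trans r0 rR) ?exprn_ge0 //.
  by rewrite mulr_ge0 ?divr_ge0 ?Gamma_ge0 // ltW.
rewrite ler_pM ?divr_ge0 ?Gamma_ge0 ?(ltW den0) // ler_pdivrMr //.
apply: (le_trans (Gamma_le_fact j m0)).
set C := (4 * m) `^ m * expR (1 / 2).
have C0 : 0 <= C by rewrite mulr_ge0 ?powR_ge0 ?expR_ge0.
rewrite [leRHS](_ : _ = beta m Omega `^ (m + j.+2%:R / 2) *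
  ((j.+2)`!%:R * (4 * C))); last by ring.
apply: (@le_trans _ _ ((j.+2)`!%:R * (4 * C))); last first.
  by rewrite ler_peMl // mulr_ge0 // mulr_ge0.
apply: ler_wpM2r; first by rewrite mulr_ge0.
by rewrite ler_nat leq_fact // leqW.
Qed.

(** Each part of the threshold has its use: [k >= 2B + 2] turns [B * k - k ^+ 2 / 2] into at most
    [- k], and after [expR (- k) <= 1 / k], [k >= A / eps] gives [A / k <= eps]. *)
Lemma gaussian_tail_le (R : realType) (A B eps : R) (k : nat) :
  0 <= A -> 0 <= B -> 0 < eps ->
  2 * B + 2 + A / eps <= k%:R ->
  A * (B ^+ k * expR (- (k%:R ^+ 2 / 2))) <= eps.
Proof.
move=> A0 B0 eps0 hk.
have Ae0 : 0 <= A / eps by rewrite divr_ge0 // ltW.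
have k0 : 0 < k%:R :> R by apply: lt_le_trans hk; lra.
have Bk : B ^+ k <= expR (B * k%:R).
  rewrite mulrC expRM_natl lerXn2r ?nnegrE ?expR_ge0 //.
  by apply: le_trans (expR_ge1Dx _); rewrite lerDr.
have le_inv : B ^+ k * expR (- (k%:R ^+ 2 / 2)) <= k%:R^-1.
  apply: (@le_trans _ _ (expR (- k%:R))).
    apply: (@le_trans _ _ (expR (B * k%:R) * expR (- (k%:R ^+ 2 / 2)))).
      by rewrite ler_wpM2r ?expR_ge0.
    by rewrite -expRD ler_expR; nra.
  rewrite expRN lef_pV2 ?posrE ?expR_gt0 //.
  by apply: le_trans (expR_ge1Dx _); rewrite lerDr.
apply: (@le_trans _ _ (A * k%:R^-1)); first by rewrite ler_wpM2l.
rewrite ler_pdivrMr // mulrC -ler_pdivrMr //; lra.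
Qed.

Theorem proposition2 (R : realType) (m Omega Rmax eps : R)
  (hm : 0 < m) (hOmega : 0 < Omega) (hRmax : 0 < Rmax)
  (heps0 : 0 < eps) (heps1 : eps < 1) :
  exists K : nat, forall r phi : R, 0 <= r <= Rmax ->
    (\sum_(K.+1 <= k <oo) (`|w m k phi| * I_km m Omega k r)%:E <= eps%:E)%E.
Proof.
pose D := 2 * ((4 * m) `^ m * expR (1 / 2)) * expR ((m + 1) * Rmax ^+ 2).
have D0 : 0 <= D by rewrite !mulr_ge0 ?powR_ge0 ?expR_ge0.
(* This is the threshold of [gaussian_tail_le] for [A = 4 * D] and [B = 2 * Rmax]: multiplying the
   bound on the [k]-th term by [2 ^ k.+1] turns [2 * D * Rmax ^+ k] into [4 * D * (2 * Rmax) ^+ k].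
   Also [x >= 2], so every [k] beyond the truncation satisfies [1 < k], as [I_km_bounds]
   requires. *)
pose x := 2 * (2 * Rmax) + 2 + (4 * D) / eps.
have x2 : 2 <= x.
  have := divr_ge0 (mulr_ge0 (ler0n R 4) D0) (ltW heps0).
  by rewrite /x; lra.
exists (Num.truncn x) => r phi hr.
have large k : (Num.truncn x < k)%N -> x <= k%:R.
  by move=> h; rewrite ltW // (lt_le_trans (truncnS_gt x)) // ler_nat.
have gt1 k : (Num.truncn x < k)%N -> (1 < k)%N.
  by move=> /large /(le_trans x2); rewrite ler_nat.
have term0 k : (Num.truncn x < k)%N -> 0 <= `|w m k phi| * I_km m Omega k r.
  by move=> /gt1 /(I_km_bounds hm hOmega hr) /andP[I0 _]; rewrite mulr_ge0.
have term_le k : (Num.truncn x < k)%N ->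
    `|w m k phi| * I_km m Omega k r <= eps / (2 ^ k.+1)%:R.
  move=> hk; have /andP[I0 Ile] := I_km_bounds hm hOmega hr (gt1 k hk).
  rewrite -/D in Ile.
  apply: (le_trans (ler_pM (normr_ge0 _) I0 (normr_w_le m phi k) Ile)).
  rewrite ler_pdivlMr ?ltr0n ?expn_gt0 // natrX [2 ^+ _.+1]exprS.
  have R20 : 0 <= 2 * Rmax by rewrite mulr_ge0 // ltW.
  have D40 : 0 <= 4 * D by rewrite mulr_ge0.
  apply: le_trans (gaussian_tail_le D40 R20 heps0 (large k hk)).
  by rewrite le_eqVlt; apply/orP; left; apply/eqP; rewrite exprMn; ring.
(* The range becomes a condition on [k], and the geometric weights [eps / 2 ^ k.+1] sum to at most
   [eps] over any set of indices. *)
rewrite eseries_cond.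
apply: le_trans (epsilon_trick0 _ (ltW heps0)).
apply: lee_nneseries => k; first by move=> _ /andP[_ hk]; rewrite lee_fin term0.
by move=> /andP[_ hk]; rewrite lee_fin term_le.
Qed.
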